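(* Let $p$ be a prime, let $k\geq 1$, let $\lambda_1\geq\lambda_2\geq\ldots\geq\lambda_k\geq 1$ be integers and let $G_{\lambda}=\mathbb{Z}_{p^{\lambda_1}}\times\mathbb{Z}_{p^{\lambda_2}}\times\cdots\times\mathbb{Z}_{p^{\lambda_k}}$. Then $$|\mathcal{E}_p(G_{\lambda})|=\sum_{r=1}^k \binom{k}{r}_{p}.$$
   Context: $\mathbb{Z}_n$ denotes the cyclic group of order $n$. For a finite abelian group $G$ and a positive integer $d$, $\mathcal{E}_d(G)=\{H\leq G : \exp(H)=d\}$ is the set of subgroups of $G$ whose exponent is exactly $d$. For integers $0\le k\le n$, the gaussian binomial coefficient is $$\binom{n}{k}_{p}=\frac{\prod_{i=1}^n(p^i-1)}{\prod_{i=1}^k(p^i-1)\prod_{i=1}^{n-k}(p^i-1)},$$ where empty products equal $1$. *)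

(* Defs.v *)
From mathcomp Require Import all_boot all_order all_algebra.
From mathcomp Require Import all_fingroup all_solvable.

Set Implicit Arguments.
Unset Strict Implicit.
Unset Printing Implicit Defensive.

Import GRing.Theory.
Local Open Scope ring_scope.

(* The canonical finite group structure on each 'Z_n is the additive one.
   'Z_n has order n only for n > 1, so this is the intended group only when
   p > 1 and every lambda i is positive. *)
Definition Glambda (p k : nat) (lambda : 'I_k -> nat) : finGroupType :=
  {dffun forall i : 'I_k, 'Z_(p ^ lambda i)}.

Definition subgroups_of_exponent (gT : finGroupType) (G : {group gT})
    (d : nat) : {set {group gT}} :=
  [set H : {group gT} | (H \subset G) && (exponent H == d)].

(* Meaningful only for k <= n and p > 1: n - k is truncated subtraction. *)
Definition gauss_binom (p n k : nat) : rat :=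
  (\prod_(1 <= i < n.+1) (p%:R ^+ i - 1)) /
  ((\prod_(1 <= i < k.+1) (p%:R ^+ i - 1)) *
   (\prod_(1 <= i < (n - k).+1) (p%:R ^+ i - 1))).

(* Main.v *)
Require Import Defs.
From mathcomp Require Import all_boot all_order all_algebra.
From mathcomp Require Import all_fingroup all_solvable.

Import Order.TTheory GRing.Theory Num.Theory.

(** Why the formula holds. In an abelian [p]-group [G], a subgroup has
    exponent exactly [p] if and only if it is elementary abelian and nontrivial. The
    elements killed by [p] form the elementary abelian subgroup ['Ohm_1(G)],
    which contains all these subgroups; sorting them by rank [r] gives the sum
    of the cardinals of ['E_p^r('Ohm_1(G))], where [r] runs from 1 to the
    [p]-rank of [G] ([card_subgroups_of_prime_exponent], [pnElem_Ohm1]).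

    In a product of cyclic groups the condition [x ^+ p = 1] is checked
    coordinate by coordinate, and each nontrivial cyclic [p]-group has exactly
    [p] solutions. So the product of [k] of them has [p]-rank [k]
    ([p_rank_Glambda]).

    It remains to count the subgroups of order [p ^ r] in an elementary
    abelian group [E] of order [p ^ n], that is, the [r]-dimensional subspaces
    of an [n]-dimensional space over the field with [p] elements
    ([card_pnElem_abelem]). Count in two ways the pairs [(H, x)] where [H] has
    rank [r.+1] and [x] is a nontrivial element of [H]. Each [H] contributes
    [p ^ r.+1 - 1] pairs. Each [x] contributes one pair for each subgroup of
    rank [r] of [E / <[x]>], a quotient of order [p ^ n.-1]. Gaussian binomials
    satisfy the same recurrence ([gauss_binomSS]), so induction on [r]
    concludes. *)

(** * Gaussian binomial coefficients *)

Lemma expr_sub1_neq0 p i : (1 < p)%N -> (0 < i)%N ->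
  (p%:R ^+ i - 1 : rat)%R != 0%R.
Proof.
by move=> p_gt1 i_gt0; rewrite subr_eq0 gt_eqF // exprn_egt1 ?ltr1n // -lt0n.
Qed.

Lemma gauss_binom0 p n : (1 < p)%N -> gauss_binom p n 0 = 1%R.
Proof.
move=> p_gt1; rewrite /gauss_binom subn0 [X in (_ / (X * _))%R]big_geq //.
rewrite mul1r divff // big_nat_cond prodf_seq_neq0; apply/allP => i _ /=.
apply/implyP; rewrite andbT => /andP[i_gt0 _]; exact: expr_sub1_neq0.
Qed.

(** Lowering both arguments keeps [n - r], so a single factor changes on each
    side. This is the recurrence that counting pairs (subgroup, nontrivial
    element) produces. *)
Lemma gauss_binomSS p n r : (1 < p)%N ->
  (gauss_binom p n.+1 r.+1 * (p%:R ^+ r.+1 - 1) =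
   (p%:R ^+ n.+1 - 1) * gauss_binom p n r)%R.
Proof.
move=> p_gt1; rewrite /gauss_binom subSS.
rewrite (big_nat_recr n.+1) //= (big_nat_recr r.+1) //=.
have nz_r := @expr_sub1_neq0 p r.+1 p_gt1 isT.
by rewrite [X in (_ / X)%R]mulrAC invfM mulrA mulfVK // mulrAC mulrC.
Qed.

(** * Subgroups of an elementary abelian group *)

(** The correspondence theorem for the quotient by [<[x]>]: [H |-> H / <[x]>]
    is a bijection from the subgroups that contain [x], and it lowers the rank
    by one because [x] has order [p]. *)
Lemma card_pnElem_containing {gT : finGroupType} {p r : nat} {E : {group gT}}
    (x : gT) : prime p -> p.-abelem%g E -> x \in E^#%g ->
  #|[set H in 'E_p^r.+1(E)%g | x \in (H : {group gT})]|
    = #|'E_p^r(E / <[x]>)%g|.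
Proof.
move=> p_pr abE /setD1P[ntx Ex]; set X := <[x]>%G.
have ox : #|X| = p by apply: (abelem_order_p abE).
have nX (H : {group gT}) : H \subset E -> x \in H -> (X <| H)%g.
  move=> sHE Hx; rewrite -sub_abelian_normal ?cycle_subG //.
  exact: abelianS sHE (abelem_abelian abE).
rewrite -(card_in_imset (f := fun H : {group gT} => (H / X)%G)); last first.
  move=> H K /setIdP[/pnElemP[sHE _ _] Hx] /setIdP[/pnElemP[sKE _ _] Kx].
  by move/(congr1 val); apply: quotient_injG; rewrite inE nX.
congr #|pred_of_set _|; apply/setP=> K.
(* The inclusion from right to left is surjectivity: [K] is the image of its
   preimage in [E]. *)
apply/imsetP/idP => [[H] | /pnElemP[sKE abK oK]].
  case/setIdP => EH Hx ->; have [sHE abH _] := pnElemP EH.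
  apply/pnElemP; split; rewrite ?quotientS ?quotient_abelem //.
  rewrite -divg_normal ?nX // (card_pnElem EH) ox expnS mulKn ?prime_gt0 //.
  exact: pfactorK.
have nXE : (X <| E)%g by apply: nX.
have [H defK sXH sHE] := inv_quotientS nXE sKE.
have Hx : x \in H by rewrite -cycle_subG.
have abH := abelemS sHE abE.
exists H; last by apply: val_inj.
rewrite inE Hx andbT; apply/pnElemP; split=> //.
have := Lagrange sXH; rewrite -card_quotient ?normal_norm ?nX //= -defK ox.
rewrite (card_pgroup (abelem_pgroup abK)) oK -expnS => <-.
exact: pfactorK.
Qed.

(** Both sides count the pairs [(H, x)] with [x] a nontrivial element of [H]:
    the left side by [H], the right side by [x]. *)
Lemma card_pnElemS {gT : finGroupType} {p r : nat} {E : {group gT}} :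
    prime p -> p.-abelem%g E ->
  #|'E_p^r.+1(E)%g| * (p ^ r.+1 - 1)
    = \sum_(x in E^#%g) #|'E_p^r(E / <[x]>)%g|.
Proof.
move=> p_pr abE.
under eq_bigr => x Ex do
  rewrite -(card_pnElem_containing x p_pr abE Ex) -sum1dep_card.
rewrite (exchange_big_dep (mem 'E_p^r.+1(E)%g)) /=; last first.
  by move=> x H _ /andP[].
rewrite -sum_nat_const; apply: eq_bigr => H EH; have [sHE _ _] := pnElemP EH.
rewrite -(card_pnElem EH) (cardsD1 1%g H) group1 add1n subn1 /= -sum1_card.
apply: eq_bigl => x; rewrite EH !inE /= -andbA.
by case Hx: (x \in H); rewrite ?andbF // (subsetP sHE).
Qed.

(** The induction on [r] ranges over all groups [E], since the double count
    replaces [E] by its quotients. *)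
Lemma card_pnElem_abelem {gT : finGroupType} {p n r : nat} {E : {group gT}} :
    prime p -> p.-abelem%g E -> #|E| = (p ^ n)%N -> (r <= n)%N ->
  (#|'E_p^r(E)%g|%:R : rat)%R = gauss_binom p n r.
Proof.
move=> p_pr; have p_gt1 := prime_gt1 p_pr.
elim: r n gT E => [|r IHr] n gT E abE oE le_rn.
  by rewrite pnElem0 cards1 gauss_binom0.
case: n => // n in oE le_rn *.
have nz_r := @expr_sub1_neq0 p r.+1 p_gt1 isT.
have natE m : ((p ^ m - 1)%N%:R : rat)%R = (p%:R ^+ m - 1)%R.
  by rewrite natrB ?natrX // expn_gt0 prime_gt0.
apply: (mulIf nz_r); rewrite gauss_binomSS // -!natE -natrM card_pnElemS //.
rewrite natr_sum (eq_bigr (fun=> gauss_binom p n r)) => [|x /setD1P[ntx Ex]].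
  by rewrite sumr_const -oE (cardsD1 1%g E) group1 add1n subn1 /= mulr_natl.
apply: IHr => //; first exact: quotient_abelem.
have nXE : (<[x]> <| E)%g.
  by rewrite -sub_abelian_normal ?cycle_subG // (abelem_abelian abE).
rewrite -divg_normal // oE (_ : #|<[x]>%g| = p) ?expnS ?mulKn ?prime_gt0 //.
exact: (abelem_order_p abE).
Qed.

(** * Subgroups of prime exponent in an abelian group *)

Lemma pnElem_Ohm1 {gT : finGroupType} (p r : nat) (G : {group gT}) :
  'E_p^r('Ohm_1(G))%g = 'E_p^r(G)%g.
Proof.
apply/setP=> H; apply/pnElemP/pnElemP=> [] [sHG abH oH]; split=> //.
  exact: subset_trans sHG (Ohm_sub 1 G).
by rewrite -(Ohm1_id abH) OhmS.
Qed.

(** The exponent of [H] divides the prime [p] when [H] is elementary abelian,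
    and it is 1 only for the trivial group: dropping the trivial group is what
    makes the sum start at 1. *)
Lemma card_subgroups_of_prime_exponent {gT : finGroupType} {p : nat}
    {G : {group gT}} : prime p -> abelian G ->
  #|subgroups_of_exponent G p| = \sum_(1 <= r < 'r_p(G)%g.+1) #|'E_p^r(G)%g|.
Proof.
move=> p_pr abG; set k := 'r_p(G)%g.
have inS H : (H \in subgroups_of_exponent G p) =
    [&& H \subset G, p.-abelem%g H & H :!=: 1%g].
  rewrite inE; case sHG: (H \subset G) => //=.
  rewrite abelemE // (abelianS sHG abG) trivg_exponent /=.
  apply/eqP/andP=> [->|[]]; first by rewrite dvdnn gtnNdvd ?prime_gt1.
  by case/primeP: p_pr => _ p_pr /p_pr /orP[] /eqP ->.
have rkS (H : {group gT}) : H \subset G -> p.-abelem%g H -> logn p #|H| < k.+1.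
  move=> sHG abH; rewrite ltnS; apply: logn_le_p_rank.
  by apply/pElemP.
have rk_gt0 (H : {group gT}) :
    p.-abelem%g H -> (0 < logn p #|H|) = (H :!=: 1%g).
  move=> abH; rewrite -cardG_gt1 {2}(card_pgroup (abelem_pgroup abH)).
  by rewrite -{2}(expn0 p) ltn_exp2l ?prime_gt1.
rewrite -sum1_card.
(* [inord] makes the rank an index of type ['I_k.+1]; [rkS] ensures that it
   does not fall back to its default value. *)
rewrite (partition_big (fun H : {group gT} => inord (logn p #|H|) : 'I_k.+1)
   (fun r : 'I_k.+1 => 0 < r)) /=; last first.
  move=> H; rewrite inS => /and3P[sHG abH ntH].
  by rewrite inordK ?rkS // rk_gt0.
rewrite big_add1 /= big_mkord big_mkcond big_ord_recl /= add0n.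
apply: eq_bigr => r _; rewrite -sum1_card; apply: eq_bigl => H.
rewrite inS; apply/andP/pnElemP => [[/and3P[sHG abH ntH] /eqP/(congr1 val)] | ].
  by rewrite /= inordK ?rkS.
case=> sHG abH oH; rewrite sHG abH -rk_gt0 // [in 0 < _]oH; split=> //.
by apply/eqP/val_inj; rewrite /= inordK ?rkS.
Qed.

(** * The p-rank of a product of cyclic p-groups *)

Lemma expg_dffun {I : finType} {gT : I -> finGroupType}
    (x : {dffun forall i : I, gT i}) n i : (x ^+ n)%g i = (x i ^+ n)%g.
Proof. by elim: n => [|n IHn]; rewrite ?oneg_ffun // !expgS mulg_ffun IHn. Qed.

Lemma Ldiv_dffun {I : finType} (gT : I -> finGroupType) n :
  'Ldiv_n([set: {dffun forall i : I, gT i}])%g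
    = setXn (fun i => 'Ldiv_n([set: gT i])%g).
Proof.
apply/setP=> x; apply/LdivP/setXnP => [[_ xn1] i | xn1].
  by apply/LdivP; rewrite inE -expg_dffun xn1 oneg_ffun.
split; rewrite ?inE //; apply/ffunP => i.
by have /LdivP[_ xin] := xn1 i; rewrite expg_dffun xin ffunE.
Qed.

Lemma expn_gt1 {p l : nat} : prime p -> (0 < l)%N -> (1 < p ^ l)%N.
Proof. by move=> p_pr l_gt0; rewrite -(expn0 p) ltn_exp2l ?prime_gt1. Qed.

Lemma card_Zp_pfactor {p l : nat} : prime p -> (0 < l)%N ->
  #|[set: 'Z_(p ^ l)]| = (p ^ l)%N.
Proof. by move=> p_pr l_gt0; rewrite cardsT card_ord Zp_cast ?expn_gt1. Qed.

(** The solutions of [x ^+ p = 1] form the unique subgroup of order [p] of a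
    nontrivial cyclic [p]-group. *)
Lemma card_Ldiv_Zp {p l : nat} : prime p -> (0 < l)%N ->
  #|'Ldiv_p([set: 'Z_(p ^ l)])%g| = p.
Proof.
move=> p_pr l_gt0; set G := [set: 'Z_(p ^ l)]%G.
have oG : #|G| = (p ^ l)%N := card_Zp_pfactor p_pr l_gt0.
have cycG : cyclic G by apply/cyclicP; exists Zp1; exact: Zp_cycle.
have pG : p.-group%g G by rewrite /pgroup oG pnatX pnat_id.
have ab1 : abelian 'Ohm_1(G).
  by apply: abelianS (Ohm_sub 1 G) (cyclic_abelian cycG).
(* [OhmEabelian] speaks of ['Ldiv_(p ^ 1)]; only this occurrence of [p] is to
   become [p ^ 1]. *)
rewrite -{2}[p]expn1 -(OhmEabelian pG ab1).
by rewrite (Ohm1_cyclic_pgroup_prime cycG pG) // -cardG_gt1 oG expn_gt1.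
Qed.

Lemma Glambda_abelian p k (lambda : 'I_k -> nat) :
  abelian [set: Glambda p lambda]%G.
Proof.
apply/centsP=> x _ y _; apply/ffunP=> i; rewrite !mulg_ffun; exact: Zp_mulgC.
Qed.

Lemma Glambda_pgroup p k (lambda : 'I_k -> nat) :
    prime p -> (forall i, (0 < lambda i)%N) ->
  p.-group%g [set: Glambda p lambda]%G.
Proof.
move=> p_pr lambda_gt0.
have ->: [set: Glambda p lambda]%G =
    setXn (fun i : 'I_k => [set: 'Z_(p ^ lambda i)]) :> {set _}.
  by apply/setP=> x; rewrite inE; apply/esym/setXnP=> i; rewrite inE.
rewrite /pgroup cardsXn; elim/big_rec: _ => // i m _; rewrite pnatM => ->.
by rewrite andbT card_Zp_pfactor // pnatX pnat_id.
Qed.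

Lemma p_rank_Glambda p k (lambda : 'I_k -> nat) :
    prime p -> (forall i, (0 < lambda i)%N) ->
  'r_p([set: Glambda p lambda]%G)%g = k.
Proof.
move=> p_pr lambda_gt0; set G := [set: Glambda p lambda]%G.
have abG : abelian G := Glambda_abelian p k lambda.
have pG : p.-group%g G := Glambda_pgroup p k lambda p_pr lambda_gt0.
have ab1 : abelian 'Ohm_1(G) by apply: abelianS (Ohm_sub 1 G) abG.
rewrite p_rank_abelian // (OhmEabelian pG ab1) expn1.
rewrite (Ldiv_dffun (fun i : 'I_k => 'Z_(p ^ lambda i))) cardsXn.
under eq_bigr => i _ do rewrite card_Ldiv_Zp //.
by rewrite prod_nat_const card_ord pfactorK.
Qed.

Theorem proposition2p3 (p k : nat) (lambda : 'I_k -> nat)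
    (p_prime : prime p) (k_ge1 : (1 <= k)%N)
    (lambda_noninc : forall i j : 'I_k, (i <= j)%N -> (lambda j <= lambda i)%N)
    (lambda_ge1 : forall i : 'I_k, (1 <= lambda i)%N) :
  ((#|subgroups_of_exponent [set: Glambda p lambda]%G p|%:R : rat) =
   \sum_(1 <= r < k.+1) gauss_binom p k r)%R.
Proof.
have abG := Glambda_abelian p k lambda.
have pG := Glambda_pgroup p k lambda p_prime lambda_ge1.
have rkG := p_rank_Glambda p k lambda p_prime lambda_ge1.
rewrite card_subgroups_of_prime_exponent // rkG natr_sum.
apply: eq_big_nat => r /andP[_ le_rk]; rewrite -pnElem_Ohm1.
apply: card_pnElem_abelem => //; first exact: Ohm1_abelem.
by rewrite (card_pgroup (pgroupS (Ohm_sub 1 _) pG)) -p_rank_abelian // rkG.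
Qed.
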